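(* Let $E$ be a nontrivial (i.e. $E\neq\{0\}$) Archimedean real vector lattice, let $n\in\mathbb{N}$, let $h\in\mathcal{H}(\mathbb{R}^n)$ be symmetric, and assume that $E$ is $h$-complete. Then the following are equivalent. (i) $h(f_1,\dots,f_n)=0$ whenever $f_1,\dots,f_n\in E^+$ and $f_i\wedge f_j=0$ for some $i,j\in[n]$. (ii) $h(0,f_1,\dots,f_{n-1})=0$ holds for all $f_1,\dots,f_{n-1}\in E^+$.
   Context: $\mathbb{N}$ is the set of strictly positive integers, $[n]:=\{1,\dots,n\}$, and $E^+$ is the positive cone of $E$. $\mathcal{H}(\mathbb{R}^n)$ is the space of continuous functions $h\colon\mathbb{R}^n\to\mathbb{R}$ that are positively homogeneous, i.e. $h(\lambda x)=\lambda h(x)$ for all real $\lambda\geq 0$ and $x\in\mathbb{R}^n$; $h$ is symmetric if its value is unchanged under every permutation of its arguments. For $f_1,\dots,f_n,g\in E$ and $h\in\mathcal{H}(\mathbb{R}^n)$, one writes $h(f_1,\dots,f_n)=g$ when $h(\omega(f_1),\dots,\omega(f_n))=\omega(g)$ holds for every nonzero real-valued vector lattice homomorphism $\omega$ defined on the vector sublattice of $E$ generated by $\{f_1,\dots,f_n,g\}$ (such a $g$ is unique if it exists). $E$ is called $h$-complete if for all $f_1,\dots,f_n\in E$ there exists $g\in E$ with $h(f_1,\dots,f_n)=g$; this yields a function $h\colon E^n\to E$, which is the one appearing in (i) and (ii). In (i), $i$ and $j$ are not required to be distinct. *)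

(* Defs.v *)
From HB Require Import structures.
From mathcomp Require Import all_boot all_order all_fingroup all_algebra.
From mathcomp Require Import all_classical all_reals all_analysis.

Set Implicit Arguments.
Unset Strict Implicit.
Unset Printing Implicit Defensive.

Import Order.TTheory GRing.Theory Num.Theory.
Import numFieldNormedType.Exports.

Local Open Scope classical_set_scope.
Local Open Scope ring_scope.

(* The lattice operations are not those of [Order.Lattice]: a structure joining
   [Order.Lattice] with [GRing.Lmodule] is rejected by Hierarchy Builder, since
   [Num.RealDomain] already joins their common ancestors. *)
HB.mixin Record POrderedLmodule_isVectorLattice (R : realType) E
    of GRing.Lmodule R E & Order.isPOrder ring_display E := {
  lev_wD2r : forall z x y : E, x <= y -> x + z <= y + z;
  lev_wpZ2l : forall (a : R) (x y : E), 0 <= a -> x <= y -> a *: x <= a *: y;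
  vmeet : E -> E -> E;
  vjoin : E -> E -> E;
  lev_meet : forall x y z : E, (z <= vmeet x y) = (z <= x) && (z <= y);
  lev_join : forall x y z : E, (vjoin x y <= z) = (x <= z) && (y <= z)
}.

#[short(type="vectorLatticeType")]
HB.structure Definition VectorLattice (R : realType) :=
  { E of GRing.Lmodule R E & Order.isPOrder ring_display E &
         POrderedLmodule_isVectorLattice R E }.

Section VectorLatticeDefs.
Context {R : realType} (E : vectorLatticeType R).

Definition archimedean_vlat :=
  forall x y : E, 0 <= x -> (forall k : nat, x *+ k <= y) -> x = 0.

Definition vector_sublattice (D : set E) :=
  [/\ D 0,
      forall (a : R) (x y : E), D x -> D y -> D (a *: x + y),
      forall x y : E, D x -> D y -> D (vmeet x y) &
      forall x y : E, D x -> D y -> D (vjoin x y)].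

Definition generated_sublattice (A : set E) : set E :=
  smallest vector_sublattice A.

(* A homomorphism with domain D is represented by a total function on E
   whose values outside D are irrelevant. *)
Definition vlat_hom_on (D : set E) (w : E -> R) :=
  [/\ forall (a : R) (x y : E), D x -> D y -> w (a *: x + y) = a * w x + w y,
      forall x y : E, D x -> D y -> w (vmeet x y) = Num.min (w x) (w y) &
      forall x y : E, D x -> D y -> w (vjoin x y) = Num.max (w x) (w y)].

Definition nonzero_on (D : set E) (w : E -> R) := exists2 x, D x & w x != 0.

End VectorLatticeDefs.

Section FunctionalCalculus.
Context {R : realType} {n : nat}.

Definition pos_homogeneous (h : 'rV[R]_n -> R) :=
  forall (a : R) (x : 'rV[R]_n), 0 <= a -> h (a *: x) = a * h x.

Definition symmetric_fun (h : 'rV[R]_n -> R) :=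
  forall (s : 'S_n) (x : 'rV[R]_n), h (col_perm s x) = h x.

Context {E : vectorLatticeType R}.

(* [fcalc_rel h f g] is the relation "h (f_1, ..., f_n) = g". *)
Definition fcalc_rel (h : 'rV[R]_n -> R) (f : 'rV[E]_n) (g : E) :=
  let D := generated_sublattice (range (f ord0) `|` [set g]) in
  forall w : E -> R, vlat_hom_on D w -> nonzero_on D w ->
    h (map_mx w f) = w g.

End FunctionalCalculus.

Definition fcalc_complete {R : realType} {n : nat} (E : vectorLatticeType R)
    (h : 'rV[R]_n -> R) :=
  forall f : 'rV[E]_n, exists g : E, fcalc_rel h f g.

(* The induced function E^n -> E.  When E is Archimedean the g chosen here is
   the only one. *)
Definition fcalc {R : realType} {n : nat} {E : vectorLatticeType R}
    {h : 'rV[R]_n -> R} (hE : fcalc_complete E h) (f : 'rV[E]_n) : E :=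
  sval (cid (hE f)).

(* Main.v *)
Require Import Defs.
From mathcomp Require Import all_boot all_order all_fingroup all_algebra.
From mathcomp Require Import all_classical all_reals all_analysis.
From mathcomp Require Import lra.

Set Implicit Arguments.
Unset Strict Implicit.
Unset Printing Implicit Defensive.

Import Order.TTheory GRing.Theory Num.Theory.
Import numFieldNormedType.Exports.

Local Open Scope classical_set_scope.
Local Open Scope ring_scope.

(* The implication (ii) -> (i) has two halves.  Testing (ii) on multiples of
   a single e > 0, with the homomorphism t e |-> t, shows that the real function
   h vanishes at every nonnegative vector having a zero coordinate.  A
   homomorphism turns f_i /\ f_j = 0 into the vanishing of w f_i or w f_j, so
   every homomorphism kills g = h(f_1, ..., f_n).  It remains to see that
   homomorphisms separate points (Yosida).  Let u be the sum of |g| and the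
   |f_k|, so that everything lives in the order ideal generated by u.  If
   |g| <> 0, the Archimedean property gives eps > 0 with |g| not below eps u.
   By Zorn there is an ideal I containing (|g| - eps u)^- and maximal among
   those missing u; it is prime, and w x = sup {t | (x - t u)^- in I} is a
   homomorphism with w |g| >= eps. *)

Section VectorLatticeTheory.
Context {R : realType} {E : vectorLatticeType R}.
Implicit Types (x y z u : E) (a t : R).

(** * Arithmetic of the order and of the lattice operations *)

Lemma lev_add2r z x y : (x + z <= y + z) = (x <= y).
Proof.
apply/idP/idP => [|/(lev_wD2r z)//].
by move=> /(lev_wD2r (- z)); rewrite !addrK.
Qed.

Lemma lev_add2l z x y : (z + x <= z + y) = (x <= y).
Proof. by rewrite ![z + _]addrC lev_add2r. Qed.

Lemma levD x y z v : x <= y -> z <= v -> x + z <= y + v.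
Proof.
move=> xy zt; apply: (@le_trans _ _ (y + z)); first by rewrite lev_add2r.
by rewrite lev_add2l.
Qed.

Lemma addv_ge0 x y : 0 <= x -> 0 <= y -> 0 <= x + y.
Proof. by move=> x0 y0; rewrite -[0]addr0 levD. Qed.

Lemma sumv_ge0 (I : Type) (r : seq I) (P : pred I) (F : I -> E) :
  (forall i, P i -> 0 <= F i) -> 0 <= \sum_(i <- r | P i) F i.
Proof. by move=> F0; elim/big_ind: _ => //; exact: addv_ge0. Qed.

Lemma subv_ge0 x y : (0 <= y - x) = (x <= y).
Proof. by have := lev_add2r x 0 (y - x); rewrite add0r subrK => <-. Qed.

Lemma levN2 x y : (- x <= - y) = (y <= x).
Proof. by rewrite -(subv_ge0 (- x)) opprK addrC subv_ge0. Qed.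

Lemma lev_subl x y z : (x - z <= y) = (x <= y + z).
Proof. by have := lev_add2r z (x - z) y; rewrite subrK => <-. Qed.

Lemma lev_pZ2l a x y : 0 < a -> (a *: x <= a *: y) = (x <= y).
Proof.
move=> a0; apply/idP/idP => [|]; last exact/lev_wpZ2l/ltW.
move=> /(@lev_wpZ2l _ _ a^-1); rewrite !scalerA mulVf ?gt_eqF// !scale1r.
by apply; rewrite invr_ge0 ltW.
Qed.

Lemma scalev_ge0 a x : 0 <= a -> 0 <= x -> 0 <= a *: x.
Proof. by move=> a0 /(lev_wpZ2l _ _ _ a0); rewrite scaler0. Qed.

Lemma lev_wpZ2r u a b : 0 <= u -> a <= b -> a *: u <= b *: u.
Proof.
by move=> u0 ab; rewrite -subv_ge0 -scalerBl scalev_ge0// subr_ge0.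
Qed.

Lemma vmeet_lel x y : vmeet x y <= x.
Proof. by have := lexx (vmeet x y); rewrite lev_meet => /andP[]. Qed.

Lemma vmeet_ler x y : vmeet x y <= y.
Proof. by have := lexx (vmeet x y); rewrite lev_meet => /andP[]. Qed.

Lemma vjoin_gel x y : x <= vjoin x y.
Proof. by have := lexx (vjoin x y); rewrite lev_join => /andP[]. Qed.

Lemma vjoin_ger x y : y <= vjoin x y.
Proof. by have := lexx (vjoin x y); rewrite lev_join => /andP[]. Qed.

Lemma vmeet_l x y : x <= y -> vmeet x y = x.
Proof.
by move=> xy; apply/le_anti; rewrite vmeet_lel lev_meet lexx.
Qed.

Lemma vmeet_r x y : y <= x -> vmeet x y = y.
Proof.
by move=> xy; apply/le_anti; rewrite vmeet_ler lev_meet lexx andbT.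
Qed.

Lemma vjoin_l x y : y <= x -> vjoin x y = x.
Proof.
by move=> xy; apply/le_anti; rewrite vjoin_gel lev_join lexx xy.
Qed.

Lemma vjoin_r x y : x <= y -> vjoin x y = y.
Proof.
by move=> xy; apply/le_anti; rewrite vjoin_ger lev_join lexx xy.
Qed.

Lemma vjoinE x y : vjoin x y = - vmeet (- x) (- y).
Proof.
apply/le_anti/andP; split.
  by rewrite lev_join; apply/andP; split; rewrite -levN2 opprK
    ?vmeet_lel ?vmeet_ler.
by rewrite -levN2 opprK lev_meet !levN2 vjoin_gel vjoin_ger.
Qed.

Lemma vjoinC x y : vjoin x y = vjoin y x.
Proof. by apply/le_anti; rewrite !lev_join !vjoin_gel !vjoin_ger. Qed.

Lemma vmeetD2r x y z : vmeet (x + z) (y + z) = vmeet x y + z.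
Proof.
apply/le_anti; rewrite lev_meet !lev_add2r vmeet_lel vmeet_ler/= andbT.
by rewrite -lev_subl lev_meet !lev_subl vmeet_lel vmeet_ler.
Qed.

Lemma vjoinD2r x y z : vjoin (x + z) (y + z) = vjoin x y + z.
Proof. by rewrite !vjoinE !opprD vmeetD2r opprD opprK. Qed.

(** * Negative parts and disjointness *)

Definition vneg x := vjoin (- x) 0.

Lemma vneg_ge0 x : 0 <= vneg x. Proof. exact: vjoin_ger. Qed.

Lemma vneg_geN x : - x <= vneg x. Proof. exact: vjoin_gel. Qed.

Lemma vneg_le x y : 0 <= y -> (vneg x <= y) = (- x <= y).
Proof. by move=> y0; rewrite lev_join y0 andbT. Qed.

Lemma vneg_homo x y : x <= y -> vneg y <= vneg x.
Proof.
move=> xy; rewrite vneg_le ?vneg_ge0//.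
by apply: le_trans (vneg_geN x); rewrite levN2.
Qed.

Lemma vnegD x y : vneg (x + y) <= vneg x + vneg y.
Proof.
rewrite vneg_le; first by rewrite opprD levD ?vneg_geN.
by rewrite addv_ge0 ?vneg_ge0.
Qed.

Lemma vneg_eq0 x : 0 <= x -> vneg x = 0.
Proof. by move=> x0; apply: vjoin_r; rewrite -(oppr0 E) levN2. Qed.

Lemma vnegZ a x : 0 <= a -> vneg (a *: x) <= a *: vneg x.
Proof.
move=> a0; rewrite vneg_le; last by rewrite scalev_ge0 ?vneg_ge0.
by rewrite -scalerN lev_wpZ2l ?vneg_geN.
Qed.

Lemma vnegI x y : vneg (vmeet x y) <= vneg x + vneg y.
Proof.
have s0 : 0 <= vneg x + vneg y by rewrite addv_ge0 ?vneg_ge0.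
rewrite vneg_le// -(opprK (_ + _)) levN2 lev_meet; apply/andP; split.
  rewrite -levN2 opprK; apply: le_trans (vneg_geN _) _.
  by rewrite -{1}[vneg x]addr0 lev_add2l vneg_ge0.
rewrite -levN2 opprK; apply: le_trans (vneg_geN _) _.
by rewrite -{1}[vneg y]add0r lev_add2r vneg_ge0.
Qed.

(** Here [vneg (- x)] is the positive part, equal to x + x^-. Translating by x^- reduces the meet to
    (0 /\ x) + x^-, and 0 /\ x = - x^-. *)
Lemma vneg_disjoint x : vmeet (vneg x) (vneg (- x)) = 0.
Proof.
have -> : vneg (- x) = x + vneg x.
  by rewrite /vneg opprK addrC -vjoinD2r addNr add0r vjoinC.
have -> : vmeet (vneg x) (x + vneg x) = vmeet 0 x + vneg x.
  by rewrite -vmeetD2r add0r.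
by rewrite /vneg vjoinC vjoinE opprK oppr0 subrr.
Qed.

(** For a > 0, a^-1 x is a lower bound of y and z, hence lies below their meet 0. *)
Lemma le0_disjoint a x y z : 0 <= a -> vmeet y z = 0 ->
  x <= a *: y -> x <= a *: z -> x <= 0.
Proof.
rewrite le_eqVlt => /predU1P[<- _|a0 yz0 xy xz]; first by rewrite scale0r.
have aK v : a *: (a^-1 *: v) = v :> E.
  by rewrite scalerA mulfV ?scale1r// lt0r_neq0.
rewrite -(aK x) -(scaler0 _ a) lev_pZ2l// -yz0 lev_meet; apply/andP.
by split; rewrite -(lev_pZ2l _ _ a0) aK.
Qed.

(** * Principal order ideals, maximal ideals and prime ideals *)

Definition order_ideal u : set E :=
  [set x | exists2 c : R, 0 <= c & x <= c *: u /\ - x <= c *: u].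

Lemma order_ideal_sublattice u : 0 <= u -> vector_sublattice (order_ideal u).
Proof.
move=> u0; split.
- by exists 0 => //; rewrite scale0r oppr0.
- move=> a x y [c c0 [cx cNx]] [d d0 [dy dNy]].
  exists (`|a| * c + d); first by rewrite addr_ge0// mulr_ge0.
  rewrite opprD -scalerN scalerDl -scalerA.
  have [a0|/ltW a0] := leP 0 a.
    by rewrite ger0_norm//; split; apply: levD => //; apply: lev_wpZ2l.
  rewrite ler0_norm//; split; apply: levD => //.
    by rewrite -[a *: x]opprK -scaleNr -scalerN lev_wpZ2l// oppr_ge0.
  by rewrite scalerN -scaleNr lev_wpZ2l// oppr_ge0.
- move=> x y [c c0 [cx cNx]] [d d0 [dy dNy]].
  (* The sum stands in for the maximum of c and d. *)
  exists (c + d); first exact: addr_ge0.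
  have cU : c *: u <= (c + d) *: u by rewrite lev_wpZ2r// lerDl.
  have dU : d *: u <= (c + d) *: u by rewrite lev_wpZ2r// lerDr.
  split; first exact: le_trans (vmeet_lel _ _) (le_trans cx cU).
  rewrite -(opprK (_ *: u)) levN2 lev_meet -levN2 opprK -(levN2 y) opprK.
  by rewrite (le_trans cNx cU) (le_trans dNy dU).
- move=> x y [c c0 [cx cNx]] [d d0 [dy dNy]].
  exists (c + d); first exact: addr_ge0.
  have cU : c *: u <= (c + d) *: u by rewrite lev_wpZ2r// lerDl.
  have dU : d *: u <= (c + d) *: u by rewrite lev_wpZ2r// lerDr.
  split; first by rewrite lev_join (le_trans cx cU) (le_trans dy dU).
  by apply: le_trans (le_trans cNx cU); rewrite levN2 vjoin_gel.
Qed.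

Lemma order_idealN u x : order_ideal u x -> order_ideal u (- x).
Proof. by move=> [c c0 [? ?]]; exists c => //; rewrite opprK. Qed.

(** An ideal is recorded through its positive elements only, and properness means missing u. The
    empty set is allowed, so nonemptiness has to come from elsewhere, such as [I v] below. *)
Definition proper_ideal u (I : set E) :=
  [/\ I `<=` [set x | 0 <= x],
      forall x y, I x -> I y -> I (x + y),
      forall x y, 0 <= x -> x <= y -> I y -> I x & ~ I u].

(** Additivity gives the multiples by positive integers, and a x lies below one of them. *)
Lemma proper_idealZ u I a x : proper_ideal u I -> 0 <= a -> I x -> I (a *: x).
Proof.
move=> [Ige0 ID Idown _] a0 Ix; have x0 : 0 <= x := Ige0 _ Ix.
have In n : I (n.+1%:R *: x).
  elim: n => [|n IH]; first by rewrite scale1r.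
  by rewrite -addn1 natrD scalerDl scale1r; apply: ID.
apply: Idown (In (Num.truncn a)); first exact: scalev_ge0.
by rewrite lev_wpZ2r// ltW// Num.Theory.truncnS_gt.
Qed.

Definition ideal_adjoin (I : set E) x : set E :=
  [set y | 0 <= y /\ exists p a, [/\ I p, 0 <= a & y <= p + a *: x]].

Lemma ideal_adjoin_proper u I x :
  (forall y z, I y -> I z -> I (y + z)) -> ~ ideal_adjoin I x u ->
  proper_ideal u (ideal_adjoin I x).
Proof.
move=> ID Iu; split=> [y []//|y z|y z y0 yz|//].
  move=> [y0 [p [a [Ip a0 yp]]]] [z0 [q [b [Iq b0 zq]]]].
  split; first exact: addv_ge0.
  exists (p + q), (a + b); split; [exact: ID|exact: addr_ge0|].
  by rewrite scalerDl addrACA levD.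
move=> [_ [p [a [Ip a0 zp]]]]; split=> //.
by exists p, a; split=> //; apply: le_trans zp.
Qed.

(** The hypothesis on v says that u is outside the ideal generated by v. The last clause of the
    conclusion is maximality: adjoining to I any positive x outside it captures u. *)
Lemma maximal_ideal_exists u v : 0 <= v -> (forall a, 0 <= a -> ~ u <= a *: v) ->
  exists I, [/\ proper_ideal u I, I v &
    forall x, 0 <= x -> ~ I x -> exists p a, [/\ I p, 0 <= a & u <= p + a *: x]].
Proof.
move=> v0 uv.
pose good I := proper_ideal u I /\ I v.
(* Zorn_bigcup also asks for the union of the empty chain, hence set0. *)
have [F goodF chainF|I [Igood Imax]] :=
    @Zorn_bigcup E [set I | I = set0 \/ good I].
  have [F0|/set0P[x0 [X0 FX0 X0x0]]] := eqVneq (\bigcup_(X in F) X) set0.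
    by left.
  (* A member of the chain that has an element is not [set0], hence is good. *)
  have Fgood X x : F X -> X x -> good X.
    by move=> /goodF[->//|].
  right; split; last first.
    by exists X0 => //; have [] := Fgood _ _ FX0 X0x0.
  split=> [x [X FX Xx]|x y [X FX Xx] [Y FY Yy]|x y x0' xy [Y FY Yy]|[X FX Xu]].
  - by have [[+ _ _ _] _] := Fgood _ _ FX Xx; apply.
  - have [XY|YX] := chainF _ _ FX FY.
      exists Y => //; have [[_ + _ _] _] := Fgood _ _ FY Yy.
      by apply=> //; apply: XY.
    exists X => //; have [[_ + _ _] _] := Fgood _ _ FX Xx.
    by apply=> //; apply: YX.
  - exists Y => //; have [[_ _ + _] _] := Fgood _ _ FY Yy.
    by apply; eauto.
  - by have [[_ _ _ +] _] := Fgood _ _ FX Xu; apply.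
(* The ideal generated by v is good, which rules out [set0] as the maximal element. *)
have adjv : good (ideal_adjoin [set 0] v).
  split; last first.
    by split=> //; exists 0, 1; rewrite add0r scale1r.
  apply: ideal_adjoin_proper => [y z -> ->|[_ [p [a [-> a0]]]]].
    exact: addr0.
  by rewrite add0r; apply: uv.
have [Iprop Iv] : good I.
  case: Igood => // I0; exfalso; apply: (Imax (ideal_adjoin [set 0] v)).
    rewrite I0 properEneq; split; last exact: sub0set.
    by apply/eqP => /esym e0; case: adjv => _; rewrite e0.
  by right.
exists I; split=> // x x0 nIx.
have [Ige0 ID Idown nIu] := Iprop.
have I0 : I 0 by apply: Idown Iv.
apply: contrapT => nu; apply: (Imax (ideal_adjoin I x)).
  split=> [y Iy|/(_ x) Ix].
    split; first exact: Ige0.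
    by exists y, 0; rewrite scale0r addr0.
  by apply/nIx/Ix; split=> //; exists 0, 1; rewrite add0r scale1r.
right; split; last first.
  by split=> //; exists v, 0; rewrite scale0r addr0.
by apply: ideal_adjoin_proper => // -[_ ?]; apply: nu.
Qed.

(** If x^- and x^+ were both outside a maximal I, then u <= p + a x^- and u <= q + b x^+ with p, q
    in I. So u - (p + q) is below (a + b) x^- and (a + b) x^+, which are disjoint; hence u <= p + q,
    and u would be in I. *)
Lemma prime_ideal_exists u v : 0 <= u -> 0 <= v ->
  (forall a, 0 <= a -> ~ u <= a *: v) ->
  exists I, [/\ proper_ideal u I, I v &
    forall x, I (vneg x) \/ I (vneg (- x))].
Proof.
move=> u0 v0 /(maximal_ideal_exists v0)[I [Iprop Iv Imax]].
exists I; split=> // x; have [Ige0 ID Idown nIu] := Iprop.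
apply: contrapT => /not_orP[nIx nINx].
have [p [a [Ip a0 upa]]] := Imax _ (vneg_ge0 _) nIx.
have [q [b [Iq b0 uqb]]] := Imax _ (vneg_ge0 _) nINx.
have p0 : 0 <= p := Ige0 _ Ip; have q0 : 0 <= q := Ige0 _ Iq.
have : u - (p + q) <= 0.
  apply: (@le0_disjoint (a + b) _ _ _ (addr_ge0 a0 b0) (vneg_disjoint x)).
    rewrite lev_subl scalerDl; apply: le_trans upa _.
    rewrite [p + _]addrC addrACA -{1}[a *: _ + p]addr0 levD//.
    by rewrite addv_ge0// scalev_ge0 ?vneg_ge0.
  rewrite lev_subl scalerDl; apply: le_trans uqb _.
  rewrite [q + _]addrC addrACA -{1}[b *: _ + q]add0r levD//.
  by rewrite addv_ge0// scalev_ge0 ?vneg_ge0.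
rewrite lev_subl add0r => upq; apply: nIu.
exact: Idown u0 upq (ID _ _ Ip Iq).
Qed.

(** * Real homomorphisms from prime ideals, and separation of points *)

Lemma ideal_hom_exists u I : 0 <= u -> proper_ideal u I ->
  (forall x, I (vneg x) \/ I (vneg (- x))) ->
  exists2 w : E -> R, vlat_hom_on (order_ideal u) w &
    forall x t, order_ideal u x -> I (vneg (x - t *: u)) -> t <= w x.
Proof.
move=> u0 Iprop Iprime; have [Ige0 ID Idown nIu] := Iprop.
have [D0 Dlin Dmeet Djoin] := order_ideal_sublattice u0.
have DN x := @order_idealN u x.
have DD x y : order_ideal u x -> order_ideal u y -> order_ideal u (x + y).
  by move=> Dx Dy; rewrite -[x]scale1r; apply: Dlin.
have DZ a x : order_ideal u x -> order_ideal u (a *: x).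
  by move=> Dx; rewrite -[_ *: _]addr0; apply: Dlin.
(* Primality at x = 0 is what makes I nonempty. *)
have I0 : I 0.
  by have := Iprime 0; rewrite oppr0 vneg_eq0// => -[].
have Ineg x y : I x -> vneg y <= x -> I (vneg y).
  by move=> Ix yx; apply: Idown Ix => //; exact: vneg_ge0.
(* Read [T x t] as t u <= x modulo I, and [T (- x) (- t)] as x <= t u modulo I. Modulo a prime ideal
   the order is total, so [T x] is the lower part of a cut of R, and its supremum is the value of x
   in units of u. *)
pose T x : set R := [set t | I (vneg (x - t *: u))].
(* The two negative parts sum to at least (t - s) u, so s < t would put u in I. *)
have Tle x s t : T x t -> T (- x) (- s) -> t <= s.
  move=> Tt Ts; rewrite leNgt; apply/negP => st; apply: nIu.
  have /(proper_idealZ Iprop (a := (t - s)^-1)) : I ((t - s) *: u).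
    apply: Idown (ID _ _ Tt Ts); first by rewrite scalev_ge0// subr_ge0 ltW.
    apply: le_trans (vnegD _ _); apply: le_trans (vneg_geN _).
    by rewrite addrACA subrr add0r opprD opprK scaleNr opprK scalerBl lexx.
  rewrite scalerA mulVf ?scale1r; last by rewrite subr_eq0 gt_eqF.
  by apply; rewrite invr_ge0 subr_ge0 ltW.
have Tdich x t : T x t \/ T (- x) (- t).
  rewrite /T/= scaleNr opprK; have [|] := Iprime (x - t *: u); first by left.
  by rewrite opprB addrC; right.
(* A two-sided bound c of x makes [T x] nonempty, through - c, and bounded above by c. *)
have Tne x : order_ideal u x -> exists c, T x (- c) /\ T (- x) (- c).
  move=> [c c0 [xc Nxc]]; exists c; rewrite /T/= scaleNr opprK.
  split; rewrite vneg_eq0//; last by rewrite addrC subv_ge0.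
  by rewrite -[x]opprK addrC subv_ge0.
have TD x y s t : T x s -> T y t -> T (x + y) (s + t).
  move=> Tx Ty; apply: Ineg (ID _ _ Tx Ty) _.
  by apply: le_trans (vnegD _ _); rewrite scalerDl opprD addrACA.
have TZ a x t : 0 <= a -> T x t -> T (a *: x) (a * t).
  move=> a0 Tx; apply: Ineg (proper_idealZ Iprop a0 Tx) _.
  by rewrite -scalerA -scalerBr vnegZ.
pose w x := sup (T x).
have w_ge x t : order_ideal u x -> T x t -> t <= w x.
  move=> /Tne[c [_ Tc]] Tt; apply: ub_le_sup => //.
  by exists c => r Tr; apply: Tle Tr Tc.
have w_le x t : order_ideal u x -> T (- x) (- t) -> w x <= t.
  move=> /Tne[c [Tc _]] Tt; apply: ge_sup; first by exists (- c).
  by move=> r Tr; apply: Tle Tr Tt.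
have w_gt x t : order_ideal u x -> t < w x -> T x t.
  move=> Dx tw; have [//|/w_le] := Tdich x t.
  by move=> /(_ Dx); rewrite leNgt tw.
have w_lt x t : order_ideal u x -> w x < t -> T (- x) (- t).
  move=> Dx tw; have [/w_ge|//] := Tdich x t.
  by move=> /(_ Dx); rewrite leNgt tw.
have w_superD x y : order_ideal u x -> order_ideal u y -> w x + w y <= w (x + y).
  move=> Dx Dy; rewrite leNgt; apply/negP => lt.
  (* With a quarter of the gap, lowering both w x and w y by d still leaves a sum above w (x +
     y). *)
  pose d := (w x + w y - w (x + y)) / 4.
  have d0 : 0 < d by rewrite /d; lra.
  have Tx : T x (w x - d) by apply: w_gt => //; lra.
  have Ty : T y (w y - d) by apply: w_gt => //; lra.
  have := w_ge _ _ (DD _ _ Dx Dy) (TD _ _ _ _ Tx Ty).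
  by rewrite /d; lra.
have wN x : order_ideal u x -> w (- x) = - w x.
  move=> Dx; apply/le_anti/andP; split.
    rewrite leNgt; apply/negP => lt.
    (* The midpoint of w (- x) and - w x. *)
    pose m := (w (- x) - w x) / 2.
    have Tm : T (- x) m by apply: w_gt; [exact: DN|rewrite /m; lra].
    have : w x <= - m by apply: w_le => //; rewrite opprK.
    by rewrite /m; lra.
  rewrite leNgt; apply/negP => lt.
  pose m := (w (- x) - w x) / 2.
  have Tm : T (- x) m by rewrite -[m]opprK; apply: w_lt => //; rewrite /m; lra.
  have : m <= w (- x) by apply: w_ge => //; exact: DN.
  by rewrite /m; lra.
have wD x y : order_ideal u x -> order_ideal u y -> w (x + y) = w x + w y.
  move=> Dx Dy; apply/le_anti; rewrite w_superD// andbT.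
  (* The reverse inequality is superadditivity at x + y and - y. *)
  have := w_superD _ _ (DD _ _ Dx Dy) (DN _ Dy).
  by rewrite addrK wN// lerBlDr.
have w_superZ a x : 0 < a -> order_ideal u x -> a * w x <= w (a *: x).
  move=> a0 Dx; rewrite leNgt -ltr_pdivrMl//; apply/negP => lt.
  have [lt1 lt2] := midf_lt lt.
  have := w_ge _ _ (DZ a _ Dx) (TZ _ _ _ (ltW a0) (w_gt _ _ Dx lt2)).
  by rewrite -ler_pdivlMl// leNgt lt1.
have wZpos a x : 0 < a -> order_ideal u x -> w (a *: x) = a * w x.
  move=> a0 Dx; apply/le_anti; rewrite w_superZ// andbT.
  have := w_superZ a (- x) a0 (DN _ Dx).
  by rewrite scalerN !wN//; [rewrite mulrN lerN2|exact: DZ].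
have w0 : w 0 = 0.
  by have := wN 0 D0; rewrite oppr0; lra.
have wZ a x : order_ideal u x -> w (a *: x) = a * w x.
  move=> Dx; have [a0|a0|->] := ltgtP a 0; last by rewrite scale0r mul0r w0.
    rewrite -[a *: x]opprK -scaleNr wN; last exact: DZ.
    by rewrite wZpos ?oppr_gt0// mulNr opprK.
  exact: wZpos.
have w_mono x y : order_ideal u x -> order_ideal u y -> x <= y -> w x <= w y.
  move=> Dx Dy xy; rewrite leNgt; apply/negP => lt.
  have [lt1 lt2] := midf_lt lt.
  suff /(w_ge _ _ Dy) : T y ((w y + w x) / 2) by rewrite leNgt lt1.
  apply: Ineg (w_gt _ _ Dx lt2) _.
  by apply: vneg_homo; rewrite lev_add2r.
have wI x y : order_ideal u x -> order_ideal u y ->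
    w (vmeet x y) = Num.min (w x) (w y).
  move=> Dx Dy; have Dxy := Dmeet _ _ Dx Dy; apply/le_anti/andP; split.
    by rewrite le_min !w_mono ?vmeet_lel ?vmeet_ler.
  rewrite leNgt; apply/negP => lt.
  (* For t strictly between the two sides, t u is below x and below y modulo I; [vnegI] carries this
     over to the meet. *)
  have [lt1 lt2] := midf_lt lt; set t := _ / 2 in lt1 lt2.
  move: lt2; rewrite lt_min => /andP[tx ty].
  suff /(w_ge _ _ Dxy) : T (vmeet x y) t by rewrite leNgt lt1.
  apply: Ineg (ID _ _ (w_gt _ _ Dx tx) (w_gt _ _ Dy ty)) _.
  by rewrite -vmeetD2r vnegI.
exists w => //; split=> [a x y Dx Dy||x y Dx Dy]; last 1 first.
- rewrite vjoinE wN; last by apply: Dmeet; exact: DN.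
  rewrite wI; [|exact: DN|exact: DN].
  by rewrite !wN// -oppr_max opprK.
- by rewrite wD ?wZ//; exact: DZ.
- exact: wI.
Qed.

Lemma vlat_hom_separates u g : archimedean_vlat E ->
  0 <= u -> order_ideal u g -> 0 <= g -> g != 0 ->
  exists2 w : E -> R, vlat_hom_on (order_ideal u) w & 0 < w g.
Proof.
move=> E_arch u0 Dg g0 gn0; have [c c0 [gc _]] := Dg.
(* If g <= eps u for every eps > 0, then k g <= u for every k, and the Archimedean property gives g
   = 0. *)
have [eps eps0 neps] : exists2 eps : R, 0 < eps & ~ g <= eps *: u.
  apply: contrapT => noeps; move/eqP: gn0; apply.
  apply: (@E_arch g u g0) => -[|k]; first by rewrite mulr0n.
  have k0 : 0 < k.+1%:R :> R by rewrite ltr0n.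
  have [gu|ng] := pselect (g <= k.+1%:R^-1 *: u).
    have := lev_wpZ2l _ _ _ (ltW k0) gu.
    by rewrite scalerA mulfV ?scale1r ?lt0r_neq0// scaler_nat.
  by exfalso; apply: noeps; exists k.+1%:R^-1; rewrite ?invr_gt0.
pose v := vneg (g - eps *: u).
have [I [Iprop Iv Iprime]] : exists I, [/\ proper_ideal u I, I v &
    forall x, I (vneg x) \/ I (vneg (- x))].
  apply: prime_ideal_exists => //; first exact: vneg_ge0.
  (* Suppose u <= a v. The positive part z of g - eps u satisfies z <= g <= c u <= c a v and is
     disjoint from v, so z <= 0 and g <= eps u. The factor 1 + c a below covers both z <= c a v and
     z <= z. *)
  move=> a a0 uav; apply: neps.
  pose z := vneg (- (g - eps *: u)).
  have z0 : 0 <= z := vneg_ge0 _.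
  have zg : z <= g.
    by rewrite vneg_le// opprK lev_subl -{1}[g]addr0 lev_add2l scalev_ge0// ltW.
  suff z_le0 : z <= 0.
    by rewrite -[eps *: u]add0r -lev_subl; apply: le_trans z_le0;
      rewrite -[X in X <= _]opprK vneg_geN.
  apply: (@le0_disjoint (1 + c * a) z v z) => //.
  - by rewrite addr_ge0// mulr_ge0.
  - exact: vneg_disjoint.
  - apply: le_trans (le_trans zg gc) _.
    apply: (@le_trans _ _ ((c * a) *: v)).
      by rewrite -scalerA lev_wpZ2l.
    by rewrite lev_wpZ2r ?vneg_ge0// lerDr.
  - by rewrite -{1}[z]scale1r lev_wpZ2r// lerDl mulr_ge0.
have [w homw wge] := ideal_hom_exists u0 Iprop Iprime.
by exists w => //; apply: lt_le_trans eps0 (wge _ _ _ Iv).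
Qed.

(** * Absolute values, and vanishing of elements given by the functional calculus *)

Lemma order_ideal_le u v x : u <= v -> order_ideal u x -> order_ideal v x.
Proof.
move=> uv [c c0 [xc Nxc]]; exists c => //; have cuv := lev_wpZ2l _ _ _ c0 uv.
by split; [apply: le_trans cuv|apply: le_trans Nxc cuv].
Qed.

Definition vabs x := vjoin x (- x).

Lemma vabs_ge0 x : 0 <= vabs x.
Proof.
have : 0 <= vabs x + vabs x.
  by rewrite -(subrr x) levD ?vjoin_gel ?vjoin_ger.
rewrite -mulr2n -scaler_nat => /(lev_wpZ2l (2^-1)).
by rewrite scaler0 scalerA mulVf ?scale1r// => ->.
Qed.

Lemma vabs_eq0 x : vabs x = 0 -> x = 0.
Proof.
move=> x0; apply/le_anti/andP; split; first by rewrite -x0 vjoin_gel.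
by rewrite -levN2 oppr0 -x0 vjoin_ger.
Qed.

Lemma order_ideal_vabs x : order_ideal (vabs x) x.
Proof. by exists 1 => //; rewrite scale1r vjoin_gel vjoin_ger. Qed.

Lemma vlat_hom_onS (D D' : set E) (w : E -> R) :
  D `<=` D' -> vlat_hom_on D' w -> vlat_hom_on D w.
Proof.
move=> sub [wl wi wj].
by split=> *; [apply: wl|apply: wi|apply: wj]; apply: sub.
Qed.

Lemma generated_sublatticeP (A : set E) :
  vector_sublattice (generated_sublattice A).
Proof.
split=> [D [[D0 _ _ _] _] //|a x y Dx Dy D DA|x y Dx Dy D DA|x y Dx Dy D DA];
  have := Dx _ DA; have := Dy _ DA; have [[_ Dl Di Dj] _] := DA.
- by move=> ? ?; apply: Dl.
- by move=> ? ?; apply: Di.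
- by move=> ? ?; apply: Dj.
Qed.

(** If g were nonzero, some homomorphism w on the order ideal of u would have w |g| > 0. That ideal
    contains the sublattice generated by g and the f_k, so the relation equates w g with the value
    of h at the w f_k, which is 0 by hypothesis. *)
Lemma fcalc_rel_eq0 n (h : 'rV[R]_n -> R) (f : 'rV[E]_n) (g : E) :
  archimedean_vlat E -> fcalc_rel h f g ->
  (forall w : E -> R, vlat_hom_on (generated_sublattice (range (f ord0))) w ->
     h (map_mx w f) = 0) ->
  g = 0.
Proof.
move=> E_arch fg hw; apply: vabs_eq0; apply: contrapT => /eqP gn0.
pose u := vabs g + \sum_k vabs (f ord0 k).
have sum0 : 0 <= \sum_k vabs (f ord0 k).
  by apply: sumv_ge0 => k _; exact: vabs_ge0.
have gu : vabs g <= u by rewrite -{1}[vabs g]addr0 lev_add2l.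
have u0 : 0 <= u := le_trans (vabs_ge0 g) gu.
have fu k : vabs (f ord0 k) <= u.
  rewrite /u (bigD1 k)//= addrCA -{1}[vabs _]addr0 lev_add2l.
  by rewrite addv_ge0 ?vabs_ge0 ?sumv_ge0// => l _; exact: vabs_ge0.
pose D := generated_sublattice (range (f ord0) `|` [set g]).
have Du : D `<=` order_ideal u.
  apply: smallest_sub; first exact: order_ideal_sublattice.
  move=> _ [[k _ <-]|->]; first exact: order_ideal_le (fu k) (order_ideal_vabs _).
  exact: order_ideal_le gu (order_ideal_vabs _).
have Dg : D g by apply: sub_gen_smallest; right.
have [_ Dlin _ Djoin] := generated_sublatticeP (range (f ord0) `|` [set g]).
have D0 : D 0 by case: (generated_sublatticeP (range (f ord0) `|` [set g])).
have DNg : D (- g) by rewrite -[- g]addr0 -scaleN1r; apply: Dlin.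
have [w /(vlat_hom_onS Du) homw wg] :=
  vlat_hom_separates E_arch u0 (Du _ (Djoin _ _ Dg DNg)) (vabs_ge0 g) gn0.
have [wlin _ wjoin] := homw.
have w0 : w 0 = 0.
  have := wlin 1 0 0 D0 D0; rewrite scale1r addr0 mul1r => /eqP.
  by rewrite -subr_eq0 opprD addNKr oppr_eq0 => /eqP.
have wNg : w (- g) = - w g.
  by have := wlin (-1) g 0 Dg D0; rewrite w0 !addr0 scaleN1r mulN1r.
(* Since w |g| = max (w g, - w g) is positive, w g is nonzero; this also provides the [nonzero_on]
   condition. *)
have wgn0 : w g != 0.
  apply: contraTneq wg => wg0.
  by rewrite wjoin// wNg wg0 oppr0 maxxx ltxx.
have wg0 : w g = 0.
  rewrite -(fg w homw); last by exists g.
  apply: hw; apply: vlat_hom_onS homw.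
  by apply: sub_smallest2r => [|z]; [exact: generated_sublatticeP|left].
by rewrite wg0 eqxx in wgn0.
Qed.

(** * Recovering real values of h along a ray *)

Lemma ray_hom_exists (e : E) : 0 < e -> exists2 w : E -> R,
  vlat_hom_on [set y | exists t, y = t *: e] w & forall t, w (t *: e) = t.
Proof.
move=> e0; have en0 : e != 0 by rewrite gt_eqF.
(* The coordinate along e. The default 0 is taken only off the line R e, outside the domain. *)
pose w (y : E) := xget 0 [set t : R | y = t *: e].
have inj s t : s *: e = t *: e -> s = t.
  move=> /eqP; rewrite -subr_eq0 -scalerBl scaler_eq0 (negPf en0) orbF subr_eq0.
  by move/eqP.
have wE t : w (t *: e) = t by rewrite /w; case: xgetP => [s _ /inj//|/(_ t)[]].
exists w => //; split=> [a _ _ [s ->] [t ->]|_ _ [s ->] [t ->]|_ _ [s ->] [t ->]].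
- by rewrite scalerA -scalerDl !wE.
- have [st|/ltW st] := leP s t; rewrite !wE.
    by rewrite vmeet_l ?wE ?min_l// lev_wpZ2r// ltW.
  by rewrite vmeet_r ?wE ?min_r// lev_wpZ2r// ltW.
- have [st|/ltW st] := leP s t; rewrite !wE.
    by rewrite vjoin_r ?wE ?max_r// lev_wpZ2r// ltW.
  by rewrite vjoin_l ?wE ?max_l// lev_wpZ2r// ltW.
Qed.

Lemma ray_sublattice (e : E) : 0 <= e ->
  vector_sublattice [set y | exists t, y = t *: e].
Proof.
move=> e0; split=> [|a _ _ [s ->] [t ->]|_ _ [s ->] [t ->]|_ _ [s ->] [t ->]].
- by exists 0; rewrite scale0r.
- by exists (a * s + t); rewrite scalerA -scalerDl.
- have [st|/ltW st] := leP s t; first by exists s; rewrite vmeet_l// lev_wpZ2r.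
  by exists t; rewrite vmeet_r// lev_wpZ2r.
- have [st|/ltW st] := leP s t; first by exists t; rewrite vjoin_r// lev_wpZ2r.
  by exists s; rewrite vjoin_l// lev_wpZ2r.
Qed.

(** The coordinate along e maps the vector of the x_k e back to x, and it is nonzero on the
    generated sublattice once some x_k is nonzero. For x = 0 that sublattice is {0} and has no
    nonzero homomorphism, so homogeneity is used instead. *)
Lemma fcalc_rel_ray n (h : 'rV[R]_n -> R) (e : E) (x : 'rV[R]_n) :
  pos_homogeneous h -> 0 < e ->
  fcalc_rel h (map_mx (fun t => t *: e) x) 0 -> h x = 0.
Proof.
move=> h_hom e0 hx.
have [->|/rV0Pn[k xk]] := eqVneq x 0.
  by have := h_hom 0 0 (lexx _); rewrite scale0r mul0r.
have [w homw wE] := ray_hom_exists e0.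
have -> : x = map_mx w (map_mx (fun t => t *: e) x).
  by apply/rowP => j; rewrite !mxE wE.
rewrite hx -1?[0](scale0r e) ?wE//.
  apply: vlat_hom_onS homw; apply: smallest_sub.
    exact: ray_sublattice (ltW e0).
  move=> _ [[j _ <-]|->]; first by exists (x ord0 j); rewrite mxE.
  by exists 0; rewrite scale0r.
exists (x ord0 k *: e); last by rewrite wE.
by apply: sub_gen_smallest; left; exists k => //; rewrite mxE.
Qed.

End VectorLatticeTheory.

(** * Symmetry of h, and the equivalence *)

Lemma symmetric_fun_eq0 (R : realType) (n : nat) (h : 'rV[R]_n.+1 -> R) :
  symmetric_fun h ->
  (forall y : 'rV[R]_n, (forall k, 0 <= y ord0 k) ->
     h (row_mx (0 : 'rV[R]_1) y) = 0) ->
  forall (x : 'rV[R]_n.+1) i, (forall k, 0 <= x ord0 k) -> x ord0 i = 0 -> h x = 0.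
Proof.
move=> h_sym h0 x i x0 xi; rewrite -(h_sym (tperm ord0 i)).
(* The type with 1 + n, convertible to n.+1, lets the first coordinate be split off as a block. *)
pose y : 'rV[R]_(1 + n) := col_perm (tperm ord0 i) x.
rewrite -[col_perm _ _](hsubmxK y) (_ : lsubmx y = 0).
  by apply: h0 => k; rewrite !mxE.
apply/rowP => k; rewrite ord1 !mxE (_ : @lshift 1 n _ = @ord0 n);
  last exact: val_inj.
by rewrite tpermL.
Qed.

Theorem corollary3p7 (R : realType) (E : vectorLatticeType R)
    (E_nontrivial : exists x : E, x != 0) (E_arch : archimedean_vlat E)
    (n : nat) (h : 'rV[R]_n.+1 -> R)
    (h_cont : continuous h) (h_hom : pos_homogeneous h)
    (h_sym : symmetric_fun h) (hE : fcalc_complete E h) :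
  (forall f : 'rV[E]_n.+1,
      (forall k, 0 <= f ord0 k) ->
      (exists i j, vmeet (f ord0 i) (f ord0 j) = 0) ->
      fcalc hE f = 0)
  <->
  (forall f : 'rV[E]_n,
      (forall k, 0 <= f ord0 k) ->
      fcalc hE (row_mx (0 : 'rV[E]_1) f) = 0).
Proof.
have fcalcP f : fcalc_rel h f (fcalc hE f) by exact: svalP.
split=> [fi f f0|fii f f0 [i [j fij]]].
  apply: fi => [k|].
    by rewrite mxE; case: splitP => l _; rewrite ?mxE.
  (* Both indices are the first one, where the entry is 0 and 0 /\ 0 = 0. *)
  exists ord0, ord0; rewrite mxE; case: splitP => // l _.
  by rewrite mxE vmeet_l.
have h0 : forall y : 'rV[R]_n, (forall k, 0 <= y ord0 k) ->
    h (row_mx (0 : 'rV[R]_1) y) = 0.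
  (* Nontriviality provides e = |x| > 0, and (ii) is tested on the vector of the y_k e. *)
  move=> y y0; have [x xn0] := E_nontrivial.
  have e0 : 0 < vabs x.
    rewrite lt_neqAle vabs_ge0 andbT eq_sym.
    by apply: contra_neq xn0; exact: vabs_eq0.
  pose f' : 'rV[E]_n := map_mx (fun t => t *: vabs x) y.
  have f'0 k : 0 <= f' ord0 k by rewrite mxE scalev_ge0// ltW.
  have /(fcalc_rel_ray h_hom e0) // : fcalc_rel h
      (map_mx (fun t => t *: vabs x) (row_mx (0 : 'rV_1) y)) 0.
  have <- : row_mx (0 : 'rV_1) f' = map_mx (fun t => t *: vabs x) (row_mx 0 y).
    by rewrite map_row_mx; congr row_mx; apply/rowP => k; rewrite !mxE scale0r.
  by rewrite -(fii _ f'0); exact: fcalcP.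
apply: (fcalc_rel_eq0 E_arch (fcalcP f)) => w homw.
have [wlin wmeet _] := homw.
set D := generated_sublattice _ in wlin wmeet homw.
have [D0 Dlin Dmeet _] := generated_sublatticeP (range (f ord0)).
have Df k : D (f ord0 k) by apply: sub_gen_smallest; exists k.
have w0 : w 0 = 0.
  have := wlin 1 0 0 D0 D0; rewrite scale1r addr0 mul1r => /eqP.
  by rewrite -subr_eq0 opprD addNKr oppr_eq0 => /eqP.
(* Lattice homomorphisms are positive: 0 = w (0 /\ f_k) = min (0, w f_k). *)
have wf0 k : 0 <= w (f ord0 k).
  have := wmeet 0 (f ord0 k) D0 (Df k); rewrite vmeet_l// w0 => ->.
  by rewrite ge_min lexx orbT.
have wmap0 k : 0 <= (map_mx w f) ord0 k by rewrite mxE.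
(* The minimum of w f_i and w f_j is 0, so whichever attains it is a zero coordinate. *)
have := wmeet _ _ (Df i) (Df j); rewrite fij w0.
case: leP => _ wf; [apply: (symmetric_fun_eq0 h_sym h0 (i := i))|
  apply: (symmetric_fun_eq0 h_sym h0 (i := j))] => //; by rewrite mxE -wf.
Qed.
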